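(* Let $a\ge 2$, $c>0$, $d$ be integers with $d<ca$ and $\gcd(d,a)=\gcd(d,c)=1$, let $n\ge 1$, and let $\mathbf s_j=ca^{n+j}-d$ for $j\in\mathbb N$ and $S_n=\langle\{\mathbf s_j:j\in\mathbb N\}\rangle$. Let $m=e(S_n)$, assume $m\ge2$, let $\lambda=\gcd(S_n)$, and assume that $\mathbf R_m\le\mathbf s_1/\lambda$. Then Wilf's conjecture holds for the numerical semigroup $S=(1/\lambda)S_n$, that is, $$\mathrm F(S)+1\le n(S)\cdot e(S),$$ where $n(S)$ is the number of elements of $S$ less than $\mathrm F(S)$.
   Context: $\mathbb N=\{0,1,2,\ldots\}$. For $A\subseteq\mathbb N$, $\langle A\rangle$ is the submonoid of $(\mathbb N,+)$ generated by $A$. For a nontrivial submonoid $M$ of $\mathbb N$, the minimal generating set of $M$ is the unique generating set contained in every generating set of $M$ (its elements are the nonzero elements of $M$ that are not sums of two nonzero elements of $M$; it is finite), and $e(M)$ is its cardinality. $\gcd(M)$ denotes the greatest common divisor of all elements of $M$, and with $\lambda=\gcd(M)$, $(1/\lambda)M=\{x/\lambda:x\in M\}$, which is a numerical semigroup (a submonoid of $\mathbb N$ with finite complement). For a numerical semigroup $S$, the Frobenius number $\mathrm F(S)$ is the largest element of $\mathbb N\setminus S$. The repunit numbers in base $a$ are $\mathbf R_0=0$ and $\mathbf R_k=1+a+\cdots+a^{k-1}$ for $k\ge1$. *)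

(* Defs.v *)
From HB Require Import structures.
From mathcomp Require Import all_boot all_order all_algebra.
From mathcomp Require Import finmap.
From mathcomp Require Import boolp classical_sets functions cardinality.
Set Implicit Arguments.
Unset Strict Implicit.
Unset Printing Implicit Defensive.
Local Open Scope classical_set_scope.
Local Open Scope nat_scope.

Definition submonoid (M : set nat) : Prop :=
  M 0 /\ (forall x y, M x -> M y -> M (x + y)).

Definition monoid_gen (A : set nat) : set nat := smallest submonoid A.

(* [get P] is the chosen element satisfying [P], and a junk value if there is
   none; every use of it below is a description by uniqueness. *)
Definition min_gen (M : set nat) : set nat :=
  get [set A : set nat | monoid_gen A = M /\
                         forall B, monoid_gen B = M -> A `<=` B].

(* [fset_set] sends an infinite set to [fset0]; the minimal generating set of
   a submonoid of the natural numbers is always finite. *)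
Definition emb_dim (M : set nat) : nat := #|` fset_set (min_gen M)|.

Definition gcd_set (M : set nat) : nat :=
  get [set g : nat | (forall x, M x -> g %| x) /\
                     forall k, (forall x, M x -> k %| x) -> k %| g].

(* (1/l)M; the division is exact when l = gcd_set M > 0. *)
Definition quot_set (l : nat) (M : set nat) : set nat := [set x %/ l | x in M].

Definition numerical_semigroup (S : set nat) : Prop :=
  submonoid S /\ finite_set (~` S).

(* Meaningful only when the complement of S is finite and nonempty. *)
Definition frobenius (S : set nat) : nat :=
  get [set f : nat | ~ S f /\ forall x, ~ S x -> x <= f].

Definition left_count (S : set nat) : nat :=
  #|` fset_set (S `&` [set x | x < frobenius S])|.

Definition wilf (S : set nat) : Prop :=
  frobenius S + 1 <= left_count S * emb_dim S.

Definition repunit (a k : nat) : nat := \sum_(i < k) a ^ i.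

(* The integer inside the absolute value is positive whenever d < c * a,
   0 < a, 0 < c and 0 < n, so it is then c a^(n+j) - d itself. *)
Definition sgen (a c : nat) (d : int) (n j : nat) : nat :=
  `|((c * a ^ (n + j))%N%:Z - d)%R|%N.

Definition smon (a c : nat) (d : int) (n : nat) : set nat :=
  monoid_gen (range (sgen a c d n)).

(* Main.v *)
(* Dividing by lam turns the generators into t0 + C * R_j, with t0 and C coprime
   and R_j the repunits.  Put k = m - 1.  If R_m < t0, a decomposition of
   t0 + C * R_j with j <= m would force t0 to divide a positive number <= R_j, so
   m + 1 generators would be irreducible; hence t0 <= R_m.  Together with
   R_m <= t0 + C this yields t0 + C * R_m = (1 + C - h) * t0 + h * (t0 + C) with
   h = R_m - t0, so the generators of index <= k suffice.  The semigroup then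
   consists of the t0 * N + C * u where u is a sum of at most N repunits among
   R_1, ..., R_k, and its Apery set for t0 is
     { t0 * coin_count u + C * u : u < t0 }.

   Every Apery element lies below one whose u is a summit, and at most k numbers
   u are summits, because distinct summits have distinct defects, which are < k.
   So each gap x satisfies f - x \in S for some f in a set of at most m - 1 gaps.
   Counting these differences gives #gaps <= (m - 1) * n(S), that is,
   F + 1 <= m * n(S). *)
Require Import Defs.
From mathcomp Require Import all_boot all_order all_algebra.
From mathcomp Require Import zify.
From mathcomp Require Import boolp classical_sets functions cardinality.
From mathcomp Require Import finmap.
Set Implicit Arguments.
Unset Strict Implicit.
Unset Printing Implicit Defensive.
Local Open Scope nat_scope.

(** * Sums of the quotients [V %/ a ^ i] and repunits *)

Section FloorSum.
Variable a : nat.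
Hypothesis a_gt1 : 1 < a.

(** If [V] is the sum of [v_j * a ^ j] for [j <= k], with [v_j < a] when [j < k], this is the sum of
    the [v_j * R_j]. *)
Definition floor_sum (k V : nat) : nat := \sum_(i < k) V %/ a ^ i.+1.

Lemma expa_gt0 i : 0 < a ^ i.
Proof. by rewrite expn_gt0; lia. Qed.

Lemma repunitS k : repunit a k.+1 = repunit a k + a ^ k.
Proof. by rewrite /repunit big_ord_recr. Qed.

Lemma expn_repunit k : a ^ k = (a - 1) * repunit a k + 1.
Proof.
elim: k => [|k IH]; first by rewrite /repunit big_ord0 muln0.
rewrite repunitS expnS {1}IH; have := IH; nia.
Qed.

Lemma repunit0 : repunit a 0 = 0.
Proof. by rewrite /repunit big_ord0. Qed.

Lemma repunit1 : repunit a 1 = 1.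
Proof. by rewrite repunitS repunit0. Qed.

Lemma repunitD i j : repunit a (i + j) = repunit a i + a ^ i * repunit a j.
Proof.
elim: j => [|j IH]; first by rewrite addn0 repunit0 muln0 addn0.
by rewrite addnS !repunitS IH expnD mulnDr addnA.
Qed.

Lemma leq_repunit i j : i <= j -> repunit a i <= repunit a j.
Proof. by move=> /subnKC <-; rewrite repunitD leq_addr. Qed.

Lemma floor_sum0 V : floor_sum 0 V = 0.
Proof. by rewrite /floor_sum big_ord0. Qed.

Lemma floor_sumS k V : floor_sum k.+1 V = floor_sum k V + V %/ a ^ k.+1.
Proof. by rewrite /floor_sum big_ord_recr. Qed.

Lemma floor_sum_of0 k : floor_sum k 0 = 0.
Proof. by elim: k => [|k IH]; rewrite ?floor_sum0 // floor_sumS IH div0n. Qed.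

Lemma leq_floor_sum k V W : V <= W -> floor_sum k V <= floor_sum k W.
Proof. by move=> h; apply: leq_sum => i _; apply: leq_div2r. Qed.

Lemma leq_floor_sumD k V W :
  floor_sum k V + floor_sum k W <= floor_sum k (V + W).
Proof.
rewrite /floor_sum -big_split; apply: leq_sum => i _ /=.
by rewrite divnD ?expa_gt0 // leq_addr.
Qed.

Lemma floor_sum_succ k V :
  floor_sum k V.+1 = floor_sum k V + \sum_(i < k) (a ^ i.+1 %| V.+1).
Proof.
rewrite /floor_sum -big_split; apply: eq_bigr => i _ /=.
by rewrite divnS ?expa_gt0 // addnC.
Qed.

Lemma floor_sum_mull k V : floor_sum k.+1 (a * V) = V + floor_sum k V.
Proof.
rewrite /floor_sum big_ord_recl /= expn1 mulKn; last lia.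
congr addn; apply: eq_bigr => i _.
by rewrite /bump /= add1n (expnS a i.+1) divnMl //; lia.
Qed.

Lemma floor_sum_expn k j : j <= k -> floor_sum k (a ^ j) = repunit a j.
Proof.
elim: j k => [|j IH] [|k] // jk.
- by rewrite floor_sum0 repunit0.
- rewrite repunit0 expn0 /floor_sum big1 // => i _.
  by rewrite divn_small // -[1](expn0 a) ltn_exp2l.
- by rewrite expnS floor_sum_mull IH // repunitS addnC.
Qed.

Lemma floor_sum_expnS k : (floor_sum k (a ^ k.+1)).+1 = repunit a k.+1.
Proof.
have := @floor_sum_expn k.+1 k.+1 (leqnn _).
by rewrite floor_sumS divnn expa_gt0 addn1.
Qed.

Lemma floor_sum_addMexp k j V q : k <= j ->
  floor_sum k (V + q * a ^ j) = floor_sum k V + q * floor_sum k (a ^ j).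
Proof.
move=> kj; rewrite /floor_sum big_distrr -big_split; apply: eq_bigr => i _ /=.
have ij : i.+1 <= j by rewrite (leq_trans _ kj).
rewrite -(subnKC ij) expnD mulKn ?expa_gt0 // mulnCA [_ * (q * _)]mulnC.
by rewrite divnDMl ?expa_gt0.
Qed.

(** No carry occurs: [a ^ i] divides [V] for [i <= j], and for [i > j] the quotient ignores what
    lies below [a ^ j]. *)
Lemma floor_sum_dvd_small k j V z : a ^ j %| V -> z < a ^ j ->
  floor_sum k (V + z) = floor_sum k V + floor_sum k z.
Proof.
move=> /dvdnP[q ->] zj.
rewrite /floor_sum -big_split; apply: eq_bigr => i _ /=.
have [ij|ji] := leqP i.+1 j.
  by rewrite divnDl // dvdn_mull // dvdn_exp2l.
have zi : z < a ^ i.+1 by rewrite (leq_trans zj) // leq_exp2l // ltnW.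
rewrite (divn_small zi) addn0 -(subnKC (ltnW ji)) expnD ![_ %/ (_ * _)]divnMA.
by rewrite divnMDl ?expa_gt0 // (divn_small zj) addn0 mulnK ?expa_gt0.
Qed.

Lemma floor_sum_pred_expn k j : j <= k ->
  floor_sum k (a ^ j).-1 + j <= repunit a j.
Proof.
move=> jk; have /prednK E := expa_gt0 j.
rewrite -(floor_sum_expn jk) -{2}E floor_sum_succ E leq_add2l.
rewrite -(subnKC jk) big_split_ord /= (leq_trans _ (leq_addr _ _)) //.
rewrite -[leqLHS]card_ord -sum1_card; apply: leq_sum => i _.
by rewrite dvdn_exp2l // ltn_ord.
Qed.

(** The jump at [V] counts the [i] in [1..k] with [a ^ i] dividing [V]; these form an initial
    segment, so more than [r] of them include [r + 1]. *)
Lemma dvdn_floor_sum_jump k r V : r < k ->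
  floor_sum k V.-1 + r < floor_sum k V -> a ^ r.+1 %| V.
Proof.
case: V => [|V] rk /=; first by rewrite dvdn0.
rewrite floor_sum_succ ltn_add2l; apply: contraTT => nd; rewrite -leqNgt.
rewrite -(subnKC (ltnW rk)) big_split_ord /= [X in _ + X]big1 => [|i _].
  rewrite addn0 -[leqRHS]card_ord -sum1_card; apply: leq_sum => i _.
  exact: leq_b1.
case: (boolP (_ %| _)) => // h; case/negP: nd; apply: dvdn_trans h.
by rewrite dvdn_exp2l // ltnS leq_addr.
Qed.

Lemma floor_sum_jump_le k V : floor_sum k V <= floor_sum k V.-1 + k.
Proof.
case: V => [|V] /=; first exact: leq_addr.
rewrite floor_sum_succ leq_add2l -[leqRHS]card_ord -sum1_card.
by apply: leq_sum => i _; exact: leq_b1.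
Qed.

(** [V - (a - 1) * floor_sum k V] is the digit sum of [V], where the top digit [V %/ a ^ k] is
    unrestricted. *)
Lemma floor_sum_bound k V : (a - 1) * floor_sum k V + V %/ a ^ k <= V.
Proof.
elim: k => [|k IH]; first by rewrite floor_sum0 muln0 divn1.
rewrite floor_sumS expnSr divnMA; apply: leq_trans IH.
have := leq_trunc_div (V %/ a ^ k) a; move: (_ %/ a ^ k) => y.
by move: (y %/ a) => z h; nia.
Qed.

End FloorSum.

(** * Least number of repunits with a given sum *)

Section LeastValue.
Variables a k : nat.
Hypotheses (a_gt1 : 1 < a) (k_gt0 : 0 < k).

(* [u] is a sum of at most [N] repunits among R_1, ..., R_k: such sums correspond
   to sums of [N] powers a^0, ..., a^k equal to [N + (a - 1) * u], since
   a^j = 1 + (a - 1) * R_j; see [attainable_in_submonoid]. *)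
Definition attainable (N u : nat) : bool :=
  u <= floor_sum a k (N + (a - 1) * u).

Lemma attainableD N N' u u' : attainable N u -> attainable N' u' ->
  attainable (N + N') (u + u').
Proof.
move=> h h'; apply: leq_trans (leq_add h h') _.
by apply: leq_trans (leq_floor_sumD a_gt1 _ _ _) _; rewrite mulnDr addnACA.
Qed.

Lemma leq_floor_sum_mull u : u <= floor_sum a k (a * u).
Proof. by case: (k) k_gt0 => // l _; rewrite floor_sum_mull // leq_addr. Qed.

Lemma attainable_leq N u : u <= N -> attainable N u.
Proof.
move=> uN; apply: leq_trans (leq_floor_sum_mull u) _.
apply: leq_floor_sum; nia.
Qed.

Lemma attainable_repunit j : j <= k -> attainable 1 (repunit a j).
Proof. by move=> jk; rewrite /attainable addnC -expn_repunit // floor_sum_expn. Qed.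

Lemma least_value_subproof u : exists V, u <= floor_sum a k V.
Proof. by exists (a * u); exact: leq_floor_sum_mull. Qed.

Definition least_value u := ex_minn (least_value_subproof u).

Lemma least_valueP u : u <= floor_sum a k (least_value u).
Proof. by rewrite /least_value; case: ex_minnP. Qed.

(** A Galois connection between [least_value] and the monotone [floor_sum a k]. *)
Lemma least_value_leq u V : (least_value u <= V) = (u <= floor_sum a k V).
Proof.
rewrite /least_value; case: ex_minnP => W hW minW; apply/idP/idP; last exact: minW.
by move=> /(leq_floor_sum a k); apply: leq_trans.
Qed.

Lemma least_value_gt u V : (V < least_value u) = (floor_sum a k V < u).
Proof. by rewrite !ltnNge least_value_leq. Qed.

(* The least number of repunits among R_1, ..., R_k with sum [u]. *)
Definition coin_count u := least_value u - (a - 1) * u.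

(** By [floor_sum_bound] the subtraction in [coin_count] is never truncated. *)
Lemma coin_countK u : coin_count u + (a - 1) * u = least_value u.
Proof.
apply: subnK; apply: leq_trans (leq_trans (leq_addr _ _) (floor_sum_bound a_gt1 k _)).
by rewrite leq_mul2l least_valueP orbT.
Qed.

Lemma coin_count_leq N u : (coin_count u <= N) = attainable N u.
Proof. by rewrite /attainable -least_value_leq -coin_countK leq_add2r. Qed.

Definition defect u := floor_sum a k (least_value u) - u.

Lemma defectK u : u + defect u = floor_sum a k (least_value u).
Proof. by rewrite subnKC // least_valueP. Qed.

Lemma least_value_pred u : 0 < u -> floor_sum a k (least_value u).-1 < u.
Proof.
move=> u0; rewrite -least_value_gt; case E: (least_value u) => [|V] //=.
by have := least_valueP u; rewrite E floor_sum_of0 leqNgt u0.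
Qed.

Lemma least_value0 : least_value 0 = 0.
Proof. by apply/eqP; rewrite -leqn0 least_value_leq. Qed.

Lemma defect_lt u : defect u < k.
Proof.
case: (posnP u) => [->|u0]; first by rewrite /defect least_value0 floor_sum_of0.
have := floor_sum_jump_le a_gt1 k (least_value u).
by have := least_value_pred u0; rewrite -defectK; lia.
Qed.

(** For [u > 0] the floor sum is below [u] just before [least_value u] and equals [u + defect u]
    there, a jump of more than [defect u]. *)
Lemma dvdn_least_value u : a ^ (defect u).+1 %| least_value u.
Proof.
case: (posnP u) => [->|u0]; first by rewrite least_value0 dvdn0.
apply: (@dvdn_floor_sum_jump _ a_gt1 k); first exact: defect_lt.
by rewrite -defectK ltn_add2r least_value_pred.
Qed.

Lemma least_value_step u : let r := (defect u).+1 in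
  least_value (u + repunit a r) = least_value u + a ^ r.
Proof.
move=> r; have rk : r <= k by exact: defect_lt.
apply/eqP; rewrite eqn_leq least_value_leq; apply/andP; split.
  apply: leq_trans (leq_floor_sumD a_gt1 _ _ _).
  by rewrite floor_sum_expn // leq_add2r least_valueP.
have p := expa_gt0 a_gt1 r.
(* One below the claimed value the floor sum splits, because [a ^ r] divides [least_value u]; it is
   at most [u + (r - 1) + (repunit a r - r)]. *)
rewrite -(prednK p) addnS least_value_gt.
rewrite (floor_sum_dvd_small a_gt1 _ (dvdn_least_value u)) -/r ?prednK //.
have := floor_sum_pred_expn a_gt1 rk; have := defectK u; rewrite /r; lia.
Qed.

Lemma coin_count_step u : coin_count (u + repunit a (defect u).+1) = (coin_count u).+1.
Proof.
have := least_value_step u; rewrite /= -!coin_countK (expn_repunit a_gt1) mulnDr; lia.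
Qed.

(** The two least values are distinct multiples of [a ^ (defect u).+1], so they differ by at least
    that power; superadditivity of the floor sum carries this over to [u] and [u']. *)
Lemma defect_gap u u' : u < u' -> defect u = defect u' ->
  u + repunit a (defect u).+1 <= u'.
Proof.
move=> uu' E; have rk := defect_lt u; set r := defect u in E rk *.
have dv := dvdn_least_value u; have dv' := dvdn_least_value u'.
  rewrite -E in dv'.
have lv : least_value u < least_value u'.
  rewrite ltn_neqAle least_value_leq (leq_trans (ltnW uu')) ?least_valueP // andbT.
  by apply/eqP => e; have := defectK u; have := defectK u'; rewrite -E -/r e; lia.
have step : least_value u + a ^ r.+1 <= least_value u'.
  rewrite -leq_subRL ?(ltnW lv) //.
  by apply: dvdn_leq; [rewrite subn_gt0 | exact: dvdn_sub dv' dv].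
have := leq_floor_sum a k step; rewrite -defectK -E.
have := leq_floor_sumD a_gt1 k (least_value u) (a ^ r.+1).
rewrite floor_sum_expn // -defectK -/r; lia.
Qed.

(** Dropping one coin and [repunit a k.+1] lowers [N + (a - 1) * u] by [a ^ k.+1], hence its floor
    sum by exactly [repunit a k.+1 - 1]. *)
Lemma attainable_sub_repunit N u : attainable N u -> repunit a k.+1 <= u ->
  0 < N /\ attainable N.-1 (u - repunit a k.+1).
Proof.
rewrite /attainable => h Ru.
have E := expn_repunit a_gt1 k.+1; have FE := floor_sum_expnS a_gt1 k.
have N0 : 0 < N.
  (* With no coins, [floor_sum_bound] forces the quotient by [a ^ k] to vanish, yet it is at least
     [1] here. *)
  case: N h => // h; rewrite add0n in h.
  have B := floor_sum_bound a_gt1 k ((a - 1) * u).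
  have : a ^ k <= (a - 1) * u.
    have : (a - 1) * repunit a k.+1 <= (a - 1) * u by rewrite leq_mul2l Ru orbT.
    by have := expa_gt0 a_gt1 k; move: E; rewrite expnS; nia.
  rewrite -(leq_pmul2r (ltn0Sn 0)) !muln1 -[leqLHS]mul1n -leq_divRL ?expa_gt0 //.
  have : (a - 1) * u <= (a - 1) * floor_sum a k ((a - 1) * u).
    by rewrite leq_mul2l h orbT.
  lia.
split=> //; set V := N.-1 + (a - 1) * (u - repunit a k.+1).
have VE : N + (a - 1) * u = V + 1 * a ^ k.+1.
  have : (a - 1) * repunit a k.+1 <= (a - 1) * u by rewrite leq_mul2l Ru orbT.
  by rewrite /V mulnBr; lia.
by move: h; rewrite VE floor_sum_addMexp //; lia.
Qed.

End LeastValue.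

(** * From attainable pairs to elements of a submonoid *)

Section AttainableInMonoid.
Variables (a t0 C : nat) (S : set nat).
Hypotheses (a_gt1 : 1 < a) (Sm : submonoid S).

Lemma submonoidM n x : S x -> S (n * x).
Proof.
case: Sm => S0 SD Sx; elim: n => [|n IH]; first by rewrite mul0n.
by rewrite mulSn; exact: SD.
Qed.

(* A representation of [u] is read off by taking as many coins [repunit a k] as
   the excess of [u] over [floor_sum (k - 1)] forces. *)
Lemma attainable_in_submonoid k N u :
  (forall j, j <= k -> S (t0 + C * repunit a j)) ->
  attainable a k N u -> S (t0 * N + C * u).
Proof.
elim: k N u => [|k IH] N u gens.
  rewrite /attainable floor_sum0 leqn0 => /eqP->; rewrite muln0 addn0 mulnC.
  apply: submonoidM; have := gens 0 (leqnn _).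
  by rewrite repunit0 muln0 addn0.
have gens' j : j <= k -> S (t0 + C * repunit a j).
  by move=> jk; apply: gens; rewrite leqW.
rewrite /attainable; set V := N + (a - 1) * u => h.
have [le|gt] := leqP u (floor_sum a k V); first exact: IH.
set q := u - floor_sum a k V.
have qV : q * a ^ k.+1 <= V.
  by rewrite -leq_divRL ?expa_gt0 // /q leq_subLR -floor_sumS.
have E := expn_repunit a_gt1 k.+1; have FE := floor_sum_expnS a_gt1 k.
set V' := V - q * a ^ k.+1.
have VV' : V = V' + q * a ^ k.+1 by rewrite /V' subnK.
have := congr1 (floor_sum a k) VV'; rewrite floor_sum_addMexp // => LV.
have uE : u = floor_sum a k V' + q * repunit a k.+1 by rewrite /q -FE in LV *; nia.
(* Each removed coin takes [1 + (a - 1) * repunit a k.+1] from [V], so [V'] is the value of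
   [floor_sum a k V'] with [N - q] coins. *)
have VE : V' + q = N + (a - 1) * floor_sum a k V'.
  by move: VV'; rewrite /V {1}uE E; nia.
have qN : q <= N.
  have := leq_trans (leq_addr _ _) (floor_sum_bound a_gt1 k V'); lia.
have -> : t0 * N + C * u =
  q * (t0 + C * repunit a k.+1) + (t0 * (N - q) + C * floor_sum a k V').
  by rewrite uE -{1}(subnKC qN); lia.
case: (Sm) => _; apply; first by apply: submonoidM; exact: gens.
apply: IH gens' _; rewrite /attainable; apply: leq_floor_sum; lia.
Qed.

End AttainableInMonoid.

(** * Irreducible elements and the embedding dimension *)

Section MinimalGenerators.
Local Open Scope classical_set_scope.

Lemma monoid_gen_submonoid A : submonoid (monoid_gen A).
Proof.
split=> [B [[B0 _] _] //|x y Ax Ay B [Bm AB]].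
by case: (Bm) => _; apply; [exact: Ax | exact: Ay].
Qed.

Lemma sub_monoid_gen A : A `<=` monoid_gen A.
Proof. exact: sub_gen_smallest. Qed.

Lemma monoid_gen_min A B : submonoid B -> A `<=` B -> monoid_gen A `<=` B.
Proof. exact: smallest_sub. Qed.

Definition irreducibles (M : set nat) : set nat :=
  [set x | [/\ M x, x != 0 &
    forall y z, M y -> M z -> y != 0 -> z != 0 -> x != y + z]].

Lemma irreducibles_gen M : submonoid M -> monoid_gen (irreducibles M) = M.
Proof.
move=> Mm; apply/seteqP; split; first by apply: monoid_gen_min => // x [].
case: (monoid_gen_submonoid (irreducibles M)) => G0 GD x.
elim/ltn_ind: x => x IH Mx; have [->//|x0] := eqVneq x 0.
have [irr|] := pselect (irreducibles M x); first exact: sub_monoid_gen.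
move=> nirr; apply: contrapT => nG; apply: nirr; split=> // y z My Mz y0 z0.
by apply/eqP => xE; apply: nG; rewrite xE; apply: GD; apply: IH => //; lia.
Qed.

(** If [B] missed an irreducible [x], it would generate only a part of [M] without [x], since
    removing [x] leaves a submonoid. *)
Lemma irreducibles_sub_gen M B : monoid_gen B = M -> irreducibles M `<=` B.
Proof.
move=> BM x [Mx x0 irr]; apply: contrapT => nB.
have [M0 MD] : submonoid M by rewrite -BM; exact: monoid_gen_submonoid.
have : monoid_gen B `<=` [set y | M y /\ y <> x].
  apply: monoid_gen_min; last first.
    move=> y By; split; first by rewrite -BM; exact: sub_monoid_gen.
    by move=> yx; apply: nB; rewrite -yx.
  split=> [|y z [My yx] [Mz zx]]; first by split=> //; apply/eqP; rewrite eq_sym.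
  split; first exact: MD.
  have [->|y0] := eqVneq y 0; first by rewrite add0n.
  have [->|z0] := eqVneq z 0; first by rewrite addn0.
  by move=> e; have := irr y z My Mz y0 z0; rewrite e eqxx.
by move=> /(_ x); rewrite BM => /(_ Mx) [].
Qed.

Lemma min_genE M : submonoid M -> min_gen M = irreducibles M.
Proof.
move=> Mm; have [] : [set A | monoid_gen A = M /\
    forall B, monoid_gen B = M -> A `<=` B] (min_gen M).
  apply: (@getPex _ [set A | monoid_gen A = M /\
    forall B, monoid_gen B = M -> A `<=` B]).
  exists (irreducibles M).
  by split; [exact: irreducibles_gen | exact: irreducibles_sub_gen].
move=> gen min; apply/seteqP; split; first exact: min (irreducibles_gen Mm).
exact: irreducibles_sub_gen.
Qed.

Lemma submonoid_muln l M : submonoid M -> submonoid (muln l @` M).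
Proof.
move=> [M0 MD]; split; first by exists 0; rewrite ?muln0.
by move=> _ _ [x Mx <-] [y My <-]; exists (x + y); [exact: MD | rewrite mulnDr].
Qed.

Lemma monoid_gen_muln l A : monoid_gen (muln l @` A) = muln l @` monoid_gen A.
Proof.
apply/seteqP; split.
  apply: monoid_gen_min; first exact/submonoid_muln/monoid_gen_submonoid.
  by move=> _ [x Ax <-]; exists x => //; exact: sub_monoid_gen.
suff : monoid_gen A `<=` [set x | monoid_gen (muln l @` A) (l * x)].
  by move=> h _ [x Ax <-]; exact: h.
have [G0 GD] := monoid_gen_submonoid (muln l @` A).
apply: monoid_gen_min; last by move=> x Ax; apply: sub_monoid_gen; exists x.
by split=> [|x y /= hx hy]; rewrite /= ?muln0 // mulnDr; exact: GD.
Qed.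

Lemma quot_set_muln l M : 0 < l -> quot_set l (muln l @` M) = M.
Proof.
move=> l0; apply/seteqP; split=> [_ [_ [x Mx <-] <-]|x Mx].
  by rewrite mulKn.
by exists (l * x); [exists x | rewrite mulKn].
Qed.

Lemma irreducibles_muln l M : 0 < l ->
  irreducibles (muln l @` M) = muln l @` irreducibles M.
Proof.
move=> l0; apply/seteqP; split.
  move=> _ [[x Mx <-] lx0 irr]; exists x => //; split=> //.
    by apply: contraNneq lx0 => ->; rewrite muln0.
  move=> y z My Mz y0 z0; apply: contraTneq isT => xE.
  have := irr (l * y) (l * z); rewrite xE mulnDr eqxx !muln_eq0 !negb_or -lt0n l0.
  by move=> /(_ (ex_intro2 _ _ y My erefl) (ex_intro2 _ _ z Mz erefl) y0 z0).
move=> _ [x [Mx x0 irr] <-]; split; first by exists x.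
  by rewrite muln_eq0 negb_or -lt0n l0.
move=> _ _ [y My <-] [z Mz <-]; rewrite !muln_eq0 !negb_or => /andP[_ y0] /andP[_ z0].
by rewrite -mulnDr eqn_mul2l negb_or -lt0n l0; exact: irr.
Qed.

Lemma emb_dim_muln l M : 0 < l -> submonoid M ->
  emb_dim (muln l @` M) = emb_dim M.
Proof.
move=> l0 Mm; rewrite /emb_dim !min_genE //; last exact: submonoid_muln.
rewrite irreducibles_muln //; set I := irreducibles M.
have inj : injective (muln l) by move=> x y /eqP; rewrite eqn_pmul2l // => /eqP.
have [fI|nI] := pselect (finite_set I).
  by rewrite fset_set_image // card_imfset.
(* In the infinite case both sides are the default [fset0]; a finite image would make [I] finite
   through division by [l]. *)
rewrite /fset_set; case: pselect => [fI|_]; last by case: pselect.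
case: nI; apply: (sub_finite_set _ (finite_image (divn^~ l) fI)) => x Ix.
by exists (l * x); [exists x | exact: mulKn].
Qed.

Lemma emb_dim_le1 M : submonoid M -> M 1 -> emb_dim M <= 1.
Proof.
move=> Mm M1; rewrite /emb_dim min_genE //.
have sub1 : irreducibles M `<=` [set 1].
  move=> x [Mx x0 irr]; apply: contrapT => x1.
  have Mx1 : M x.-1 by rewrite -[x.-1]muln1; exact: submonoidM.
  by have := irr 1 x.-1 M1 Mx1 isT;
    case: x x0 x1 {Mx irr Mx1} => [|[|x]] //= _ _ /(_ isT); rewrite eqxx.
rewrite -[leqRHS](cardfs1 1) -fset_set1; apply: fsubset_leq_card.
by rewrite -fset_set_sub //; apply: sub_finite_set sub1 _; exact: finite_set1.
Qed.

(** A positive [emb_dim] rules out the default [fset0], so the irreducibles form a finite set. *)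
Lemma leq_emb_dim M (s : seq nat) : submonoid M -> 0 < emb_dim M -> uniq s ->
  (forall x, x \in s -> irreducibles M x) -> size s <= emb_dim M.
Proof.
move=> Mm; rewrite /emb_dim min_genE // => pos us sI.
have fI : finite_set (irreducibles M).
  by apply: contrapT => nI; move: pos; rewrite /fset_set; case: pselect.
apply: uniq_leq_size => // x xs; rewrite in_fset_set //; apply/mem_set; exact: sI.
Qed.

End MinimalGenerators.

(** * Counting gaps against small elements *)

Section Counting.
Local Open Scope classical_set_scope.

Lemma numerical_semigroup_of_cover S (fs : seq nat) : submonoid S ->
  (forall x, ~ S x -> exists f s, [/\ f \in fs, S s & x + s = f]) ->
  numerical_semigroup S.
Proof.
move=> Sm cover; split=> //.
apply: (sub_finite_set _ (finite_II (\max_(f <- fs) f).+1)) => x.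
move=> /cover[f [s [ffs _ E]]] /=; rewrite ltnS.
apply: (@leq_trans f); first by rewrite -E leq_addr.
exact: (@leq_bigmax_seq _ _ xpredT id).
Qed.

Lemma frobeniusP S : finite_set (~` S) -> (exists x, ~ S x) ->
  ~ S (frobenius S) /\ forall x, ~ S x -> x <= frobenius S.
Proof.
move=> /finite_seqP[s sE] [x nx].
have mem y : ~ S y -> y \in s by move=> ny; have : (~` S) y by []; rewrite sE.
have exP : exists y, `[< ~ S y >] by exists x; apply/asboolP.
have bnd y : `[< ~ S y >] -> y <= \max_(z <- s) z.
  by by move=> /asboolP/mem ys; exact: (@leq_bigmax_seq _ _ xpredT id).
have [f /asboolP nf fmax] := ex_maxnP exP bnd.
apply: (@getPex _ [set f : nat | ~ S f /\ forall x, ~ S x -> x <= f]).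
by exists f; split=> // y ny; apply: fmax; apply/asboolP.
Qed.

(* Each gap [x <= F] is some [f - s], with [s] an element of [S] below [F]; there
   are [size fs * left_count S] such differences. *)
Lemma wilf_of_cover S (fs : seq nat) : submonoid S -> (exists x, ~ S x) ->
  (forall f, f \in fs -> ~ S f) ->
  (forall x, ~ S x -> exists f s, [/\ f \in fs, S s & x + s = f]) ->
  size fs < emb_dim S -> wilf S.
Proof.
move=> Sm exgap fsN cover size_fs.
have [_ fin] := numerical_semigroup_of_cover Sm cover.
have [nF maxF] := frobeniusP fin exgap; rewrite /wilf /left_count.
set F := frobenius S in nF maxF *.
pose ls := [seq s <- iota 0 F | `[< S s >]].
pose gs := [seq x <- iota 0 F.+1 | ~~ `[< S x >]].
have finL : finite_set (S `&` [set x | x < F]) by exact/finite_setIr/finite_II.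
have -> : #|` fset_set (S `&` [set x | x < F])| = size ls.
  rewrite -(undup_id (filter_uniq _ (iota_uniq 0 F)) : undup ls = ls) -card_fseq.
  congr (#|` _|); apply/fsetP => x; rewrite in_fset_set // !inE /= mem_filter.
  rewrite mem_iota add0n /=; apply/idP/andP.
    by move=> /set_mem[Sx xF]; split=> //; apply/asboolP.
  by move=> [/asboolP Sx xF]; apply/mem_set.
(* [F] is itself a gap, so [gs] and [ls] together exhaust [0, ..., F]. *)
have sizeE : size gs + size ls = F + 1.
  rewrite !size_filter addnC addn1 -[RHS](size_iota 0 F.+1).
  rewrite -[RHS](count_predC (fun x => `[< S x >])); congr (_ + _).
  rewrite -addn1 iotaD count_cat /= add0n.
  by case: asboolP nF => //= _ _; rewrite !addn0.
have : size gs <= size fs * size ls.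
  rewrite -(size_allpairs subn fs ls); apply: uniq_leq_size.
    exact/filter_uniq/iota_uniq.
  move=> x; rewrite mem_filter => /andP[/asboolP /cover[f [s [ffs Ss xs]]] _].
  apply/allpairsP; exists (f, s); split=> //=; last by rewrite -xs addnK.
  rewrite mem_filter mem_iota add0n; apply/andP; split; first exact/asboolP.
  have fF := maxF f (fsN f ffs); rewrite leq0n /= ltn_neqAle; apply/andP; split.
    by apply/eqP => sF; apply: nF; rewrite -sF.
  by rewrite (leq_trans _ fF) // -xs leq_addl.
move=> le; rewrite -sizeE; apply: (@leq_trans ((size fs).+1 * size ls)).
  by rewrite mulSn addnC leq_add2l.
by rewrite mulnC leq_mul2l size_fs orbT.
Qed.

End Counting.

(** * The monoid generated by the [t0 + C * R_j] *)

Section RepunitShifts.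
Local Open Scope classical_set_scope.
Variables a t0 C : nat.
Hypotheses (a_gt1 : 1 < a) (t0_gt0 : 0 < t0) (cop : coprime t0 C).

Let gen j := t0 + C * repunit a j.
Let S := monoid_gen (range gen).

Let S_submonoid : submonoid S. Proof. exact: monoid_gen_submonoid. Qed.

Let S_gen j : S (gen j).
Proof. by apply: sub_monoid_gen; exists j. Qed.

Lemma gen_irreducible j : repunit a j < t0 -> irreducibles S (gen j).
Proof.
move=> Rj; split=> //; first by rewrite /gen; lia.
(* [N] counts generators and [u] adds up their repunits; the clause [N = 0 -> u = 0] gives nonzero
   elements [N > 0], so a sum of two of them uses at least two generators. *)
pose W := [set x | exists N u, x = t0 * N + C * u /\ (N = 0 -> u = 0)].
have sub : S `<=` W.
  apply: monoid_gen_min.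
    split=> [|_ _ [N [u [-> h]]] [N' [u' [-> h']]]].
      by exists 0, 0; rewrite !muln0.
    exists (N + N'), (u + u'); split; [by rewrite !mulnDr; lia|lia].
  by move=> _ [i _ <-]; exists 1, (repunit a i); split=> //; rewrite muln1.
move=> y z /sub[N [u [yE h]]] /sub[N' [u' [zE h']]] y0 z0.
have N0 : 0 < N by case: (posnP N) => // e; move: y0; rewrite yE e h // !muln0.
have N0' : 0 < N' by case: (posnP N') => // e; move: z0; rewrite zE e h' // !muln0.
apply/eqP; rewrite /gen yE zE => E.
have CE : t0 * (N + N' - 1) = C * (repunit a j - (u + u')).
  by rewrite !mulnBr !mulnDr muln1; lia.
have : t0 %| repunit a j - (u + u').
  by rewrite -(Gauss_dvdr _ cop) -CE dvdn_mulr.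
have [e|gt] := posnP (repunit a j - (u + u')).
  by move: CE; rewrite e muln0 => /eqP; rewrite muln_eq0; lia.
by move=> /(dvdn_leq gt); lia.
Qed.

Lemma leq_repunit_emb_dim : 0 < emb_dim S -> t0 <= repunit a (emb_dim S).
Proof.
move=> e0; rewrite leqNgt; apply/negP => lt.
(* [C = 0] would force [t0 = 1] by coprimality, against [lt]; positivity makes [gen] injective. *)
have C0 : 0 < C.
  case: (posnP C) cop => // ->; rewrite /coprime gcdn0 => /eqP t1.
  have := leq_repunit a e0; rewrite repunit1; lia.
have inj : injective gen.
  move=> i j /eqP; rewrite eqn_add2l eqn_pmul2l // => /eqP Rij.
  have := expn_repunit a_gt1 i; rewrite Rij -expn_repunit // => /eqP.
  by rewrite eqn_exp2l // => /eqP.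
suff : (emb_dim S).+1 <= emb_dim S by rewrite ltnn.
rewrite -[leqLHS](size_iota 0) -(size_map gen).
apply: leq_emb_dim => //; first by rewrite map_inj_uniq // iota_uniq.
move=> _ /mapP[j + ->]; rewrite mem_iota add0n ltnS => /= je.
by apply: gen_irreducible; apply: leq_ltn_trans lt; exact: leq_repunit.
Qed.

Lemma coprime_solve x : exists2 u, u < t0 & C * u = x %[mod t0].
Proof.
have [b _] := Bezoutr C t0_gt0; rewrite gcdnC (eqP cop) => /dvdnP[q qE].
(* [b * C] is [-1] modulo [t0], and the factor [t0 - 1] restores the sign. *)
exists ((x * b * (t0 - 1)) %% t0); first exact: ltn_pmod.
rewrite modnMmr -(modnMDl (x * q) _ t0) -[RHS](modnMDl (C * x * b) _ t0).
congr (_ %% _).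
have : C * (x * b) <= C * (x * b) * t0 by rewrite leq_pmulr.
by rewrite -(mulnA x) -qE mulnBr muln1 mulnDr muln1 (mulnBr C); lia.
Qed.

(** * The Apery set of [t0] and its summits *)

Variable k : nat.
Hypotheses (k_gt0 : 0 < k) (R_ge : t0 <= repunit a k.+1)
  (R_le : repunit a k.+1 <= t0 + C).

Let S_attainable N u : attainable a k N u -> S (t0 * N + C * u).
Proof. by apply: attainable_in_submonoid => // j _; exact: S_gen. Qed.

(* For [j > k], [gen j] is expressed through [gen 0], [gen 1] and
   [gen (j - k - 1)]. *)
Lemma attainable_of_mem x : S x ->
  exists N u, attainable a k N u /\ x = t0 * N + C * u.
Proof.
move: x; apply: monoid_gen_min.
  split=> [|_ _ [N [u [h ->]]] [N' [u' [h' ->]]]].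
    by exists 0, 0; rewrite !muln0 attainable_leq.
  by exists (N + N'), (u + u'); rewrite attainableD // !mulnDr; split=> //; lia.
move=> _ [j _ <-]; elim/ltn_ind: j => j IH.
have [jk|kj] := leqP j k.
  by exists 1, (repunit a j); rewrite attainable_repunit // muln1.
have [N [u [h E]]] : exists N u, attainable a k N u /\ gen (j - k.+1) = t0 * N + C * u.
  by apply: IH; lia.
(* As [repunit a k.+1 = t0 + d], the excess [C * q * repunit a k.+1] is
   [t0 * (q * C) + C * (q * d)], with [d <= C] by [R_le]. *)
pose d := repunit a k.+1 - t0; pose q := a ^ (j - k.+1).
exists (N + q * C), (u + q * d); split.
  by apply: attainableD => //; apply: attainable_leq => //; rewrite leq_mul2l; lia.
have jE : j = j - k.+1 + k.+1 by lia.
have -> : gen j = gen (j - k.+1) + C * (q * repunit a k.+1).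
  by rewrite /gen {1}jE repunitD mulnDr addnA.
rewrite E -(subnKC R_ge) -/d; lia.
Qed.

(** Trading [t0] units of [u] for [C] coins keeps the value. If [u] reaches [repunit a k.+1], that
    repunit is removed with one coin and the surplus over [t0], at most [C], is put back; otherwise
    [u - t0 < C]. *)
Lemma reduced_of_mem x : S x ->
  exists N u, [/\ attainable a k N u, u < t0 & x = t0 * N + C * u].
Proof.
move=> /attainable_of_mem[N [u [h ->]]].
elim/ltn_ind: u N h => u IH N h; have [ut|tu] := ltnP u t0; first by exists N, u.
have [||N' [u' [h' u't E]]] := IH (u - t0) _ (N + C); first lia.
  have [Ru|uR] := leqP (repunit a k.+1) u.
    have [N0 h1] := attainable_sub_repunit a_gt1 k_gt0 h Ru.
    have -> : N + C = N.-1 + C.+1 by lia.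
    have -> : u - t0 = u - repunit a k.+1 + (repunit a k.+1 - t0) by lia.
    by apply: attainableD => //; apply: attainable_leq => //; lia.
  by apply: attainable_leq => //; lia.
exists N', u'; split=> //; rewrite -E mulnDr mulnBr.
have : C * t0 <= C * u by rewrite leq_mul2l tu orbT.
lia.
Qed.

Definition apery u := t0 * coin_count a_gt1 k_gt0 u + C * u.

Lemma apery_mem u : S (apery u).
Proof. by apply: S_attainable; rewrite -coin_count_leq. Qed.

(** The reduced form of [x] has the same residue [u] because [C] is invertible modulo [t0], and it
    needs at least [coin_count u] coins. *)
Lemma apery_min u x : u < t0 -> S x -> x = C * u %[mod t0] -> apery u <= x.
Proof.
move=> ut /reduced_of_mem[N [u' [h u't ->]]] /eqP.
rewrite mulnC modnMDl => /eqP E; have -> : u = u'.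
  wlog le : u u' ut u't E {h} / u' <= u.
    by move=> W; case/orP: (leq_total u' u) => ?; [exact: W | apply/esym/W].
  have : t0 %| C * u - C * u' by rewrite -eqn_mod_dvd ?leq_mul2l ?le ?orbT // E.
  rewrite -mulnBr Gauss_dvdr //; have [|gt] := posnP (u - u'); first lia.
  by move=> /(dvdn_leq gt); lia.
by rewrite /apery [N * t0]mulnC leq_add2r leq_mul2l coin_count_leq h orbT.
Qed.

(* [coin_count_step] moves up from [u] to [u + R_r] with [r = defect u + 1]; the
   summits are those [u < t0] from which this step leaves the range [u < t0]. *)
Definition summits : seq nat :=
  [seq u <- iota 0 t0 | t0 <= u + repunit a (defect a_gt1 k_gt0 u).+1].

Lemma mem_summits u : u \in summits ->
  u < t0 /\ t0 <= u + repunit a (defect a_gt1 k_gt0 u).+1.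
Proof. by rewrite mem_filter mem_iota add0n => /and3P[]. Qed.

(* By [defect_gap], two summits with the same defect coincide. *)
Lemma size_summits : size summits <= k.
Proof.
rewrite -(size_iota 0 k) -(size_map (defect a_gt1 k_gt0)).
apply: uniq_leq_size; last first.
  by move=> _ /mapP[u _ ->]; rewrite mem_iota add0n /= defect_lt.
rewrite map_inj_in_uniq; first exact/filter_uniq/iota_uniq.
move=> u u' /mem_summits[ut hu] /mem_summits[u't hu'] E.
have [lt|gt|//] := ltngtP u u'.
  by have := defect_gap lt E; lia.
by have := defect_gap gt (esym E); lia.
Qed.

(** By [coin_count_step], each upward step adds exactly [gen r] to the Apery element; the climb ends
    at a summit. *)
Lemma summit_above u : u < t0 ->
  exists p s, [/\ p \in summits, S s & apery u + s = apery p].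
Proof.
have [n] := ubnP (t0 - u); elim: n u => // n IH u lt ut.
set r := (defect a_gt1 k_gt0 u).+1.
have [top|below] := leqP t0 (u + repunit a r).
  exists u, 0; rewrite addn0; split=> //; last exact: (proj1 S_submonoid).
  by rewrite mem_filter mem_iota add0n top.
have r0 : 0 < repunit a r by have := @leq_repunit a 1 r isT; rewrite repunit1.
have [|p [s [pP Ss E]]] := IH (u + repunit a r) _ below; first lia.
exists p, (gen r + s); split=> //; first exact: (proj2 S_submonoid).
by rewrite -E /apery coin_count_step /gen; lia.
Qed.

Lemma summit_cover x : ~ S x ->
  exists p s, [/\ p \in summits, S s & x + s + t0 = apery p].
Proof.
move=> nSx; have [u ut E] := coprime_solve x.
have Ex : apery u = x %[mod t0] by rewrite /apery mulnC modnMDl.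
have gen0 : gen 0 = t0 by rewrite /gen repunit0 muln0 addn0.
have lt : x < apery u.
  rewrite ltnNge; apply/negP => le; apply: nSx.
  have /dvdnP[q qE] : t0 %| x - apery u by rewrite -eqn_mod_dvd // Ex.
  rewrite -(subnKC le) qE; apply: (proj2 S_submonoid); first exact: apery_mem.
  by apply: (submonoidM S_submonoid); rewrite -gen0.
(* The quotient is positive as [x < apery u]; one [t0] stays on the left and the other [q] go into
   [s]. *)
have /dvdnP[[|q] qE] : t0 %| apery u - x; first by rewrite -eqn_mod_dvd ?Ex // ltnW.
  by lia.
have [p [s [pP Ss pE]]] := summit_above ut.
exists p, (q * t0 + s); split=> //; last by rewrite -pE; lia.
by apply: (proj2 S_submonoid) => //; apply: (submonoidM S_submonoid); rewrite -gen0.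
Qed.

Lemma apery_sub_gap u f : u < t0 -> f + t0 = apery u -> ~ S f.
Proof.
move=> ut E Sf; have := apery_min ut Sf _; rewrite -E => h.
suff : f + t0 <= f by lia.
by apply: h; rewrite -(modnDr f t0) E /apery mulnC modnMDl.
Qed.

Lemma repunit_shift_wilf : k < emb_dim S -> (exists x, ~ S x) ->
  numerical_semigroup S /\ wilf S.
Proof.
move=> kS exgap.
(* Without the filter, a truncated difference would give [0], which is not a gap. *)
pose fs := [seq apery p - t0 | p <- summits & t0 <= apery p].
have cover x : ~ S x -> exists f s, [/\ f \in fs, S s & x + s = f].
  move=> /summit_cover[p [s [pP Ss E]]]; exists (apery p - t0), s.
  split=> //; last by rewrite -E addnK.
  by apply/mapP; exists p => //; rewrite mem_filter pP andbT -E leq_addl.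
split; first exact: numerical_semigroup_of_cover cover.
apply: (wilf_of_cover S_submonoid exgap _ cover).
  move=> f /mapP[p]; rewrite mem_filter => /andP[le /mem_summits[pt _]] ->.
  by apply: (@apery_sub_gap p) => //; rewrite subnK.
rewrite size_map; apply: leq_ltn_trans kS; apply: leq_trans size_summits.
by rewrite size_filter count_size.
Qed.

End RepunitShifts.

(** * Reduction of [S_n] to shifted repunits *)

Lemma gcd_setP (M : set nat) :
  (exists g, (forall x, M x -> g %| x) /\
             forall k, (forall x, M x -> k %| x) -> k %| g) ->
  (forall x, M x -> gcd_set M %| x) /\
  forall k, (forall x, M x -> k %| x) -> k %| gcd_set M.
Proof. exact: getPex. Qed.

(** As [d < c * a <= c * a ^ n], the absolute value is harmless, and [a ^ j = (a - 1) * R_j + 1]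
    separates off the part depending on [j]. *)
Lemma sgen_shift a c (d : int) n j : 1 < a -> 0 < c -> (d < (c * a)%N%:Z)%R -> 0 < n ->
  0 < sgen a c d n 0 /\
  sgen a c d n j = sgen a c d n 0 + c * a ^ n * (a - 1) * repunit a j.
Proof.
move=> a1 c0 hd n0.
have le : c * a <= c * a ^ n.
  by rewrite leq_mul2l -[leqLHS]expn1 leq_exp2l // n0 orbT.
have E : c * a ^ (n + j) = c * a ^ n + c * a ^ n * (a - 1) * repunit a j.
  by rewrite expnD (expn_repunit a1 j) mulnDr mulnDr muln1 addnC -!mulnA.
by rewrite /sgen E addn0; move: (c * a ^ n * _ * _) => y; split; lia.
Qed.

Theorem mainTheorem8 (a c : nat) (d : int) (n : nat)
  (ha : 2 <= a) (hc : 0 < c) (hd : (d < (c * a)%N%:Z)%R)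
  (hda : coprimez d a%:Z) (hdc : coprimez d c%:Z) (hn : 1 <= n)
  (m : nat) (hm : m = emb_dim (smon a c d n)) (hm2 : 2 <= m)
  (lam : nat) (hlam : lam = gcd_set (smon a c d n))
  (hR : repunit a m <= sgen a c d n 1 %/ lam) :
  numerical_semigroup (quot_set lam (smon a c d n)) /\
  wilf (quot_set lam (smon a c d n)).
Proof.
have [s0_gt0 _] := sgen_shift 0 ha hc hd hn.
pose D := c * a ^ n * (a - 1); set s0 := sgen a c d n 0 in s0_gt0.
have sE j : sgen a c d n j = s0 + D * repunit a j.
  by have [] := sgen_shift j ha hc hd hn.
have gcd_dvd x : smon a c d n x -> gcdn s0 D %| x.
  move: x; apply: (@monoid_gen_min _ [set x | gcdn s0 D %| x]).
    by split=> [|x y]; [exact: dvdn0 | exact: dvdn_add].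
  move=> _ [j _ <-] /=; rewrite sE dvdn_add ?dvdn_gcdl //.
  by rewrite dvdn_mulr // dvdn_gcdr.
have mem j : smon a c d n (sgen a c d n j) by apply: sub_monoid_gen; exists j.
have gcd_max k : (forall x, smon a c d n x -> k %| x) -> k %| gcdn s0 D.
  move=> h; have k0 : k %| s0 by apply: h; exact: mem 0.
  (* [D] is the difference of the generators of index [1] and [0]. *)
  rewrite dvdn_gcd k0 /= -(dvdn_addr _ k0) -[D]muln1 -(repunit1 a) -sE.
  by apply: h; exact: mem.
have {gcd_dvd gcd_max hlam} lamE : lam = gcdn s0 D.
  have [dvd max] := gcd_setP (ex_intro _ _ (conj gcd_dvd gcd_max)).
  by apply/eqP; rewrite hlam eqn_dvd gcd_max //= max.
have lam0 : 0 < lam by rewrite lamE gcdn_gt0 s0_gt0.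
have /dvdnP[t0 t0E] : lam %| s0 by rewrite lamE dvdn_gcdl.
have /dvdnP[C CE] : lam %| D by rewrite lamE dvdn_gcdr.
have cop : coprime t0 C.
  by rewrite /coprime -(eqn_pmul2r lam0) muln_gcdl -t0E -CE -lamE mul1n.
have t0_gt0 : 0 < t0 by move: s0_gt0; rewrite t0E muln_gt0 => /andP[].
pose S := monoid_gen (range (fun j => t0 + C * repunit a j)).
have Sm : submonoid S by exact: monoid_gen_submonoid.
have smonE : smon a c d n = [set lam * x | x in S]%classic.
  rewrite -monoid_gen_muln; congr monoid_gen; rewrite image_comp.
  by apply: eq_imagel => j _ /=; rewrite sE t0E CE; lia.
rewrite smonE emb_dim_muln // in hm; rewrite smonE quot_set_muln //.
have {}hR : repunit a m <= t0 + C.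
  by move: hR; rewrite sE repunit1 muln1 t0E CE -mulnDl mulnK.
apply: (@repunit_shift_wilf a t0 C ha t0_gt0 cop m.-1).
- lia.
- by rewrite prednK ?hm; [apply: leq_repunit_emb_dim => //; rewrite -/S; lia | lia].
- by rewrite prednK //; lia.
- by rewrite -/S -hm; lia.
(* If [1] were in [S], the embedding dimension would be at most [1]. *)
- by exists 1 => S1; have := emb_dim_le1 Sm S1; lia.
Qed.
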